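(* Let $X$, $Z$ be compact Hausdorff spaces and let $(r,q)_{0,\infty}=\{(r_j,q_j)\}_{j=0}^{\infty}$ be a sequence of pairs $r_j,q_j:Z\to X$, $j\in\mathbb{N}\cup\{0\}$, where $r_j$ are single-valued surjections and $q_j$ are single-valued maps. Then $$h_{\mathfrak{p}}^Z((r,q)_{0,\infty})\leq h_{\mathfrak{m}}^Z((r,q)_{0,\infty}) \leq h_Z((r,q)_{0,\infty}) \leq h_{\mathfrak{m}}^Z((r,q)_{0,\infty}) + h_{\mathfrak{i}}^Z((r,q)_{0,\infty}).$$
   Context: A uniformity on a nonempty set $S$ is a nonempty family $\mathcal{V}$ of pseudometrics on $S$ such that: (U1) if $p_0,p_1\in\mathcal{V}$, then $\max\{p_0,p_1\}\in\mathcal{V}$; (U2) if $p$ is a pseudometric on $S$ such that for every $\varepsilon>0$ there exist $p_\varepsilon\in\mathcal{V}$ and $\delta>0$ with $p_\varepsilon(x,y)<\delta\Rightarrow p(x,y)<\varepsilon$ for all $x,y\in S$, then $p\in\mathcal{V}$; (U3) if $x\neq y$ in $S$, then $p(x,y)>0$ for some $p\in\mathcal{V}$. The induced topology has as base the balls $\{y: p(x,y)<r\}$. The (nonempty) compact Hausdorff space $Z$ carries a unique uniformity $\mathcal{V}$ inducing its topology, and this $\mathcal{V}$ is used below. The $n$-orbits of coincidences are $\mathrm{Coin}_1((r,q)_{0,\infty})=Z$ and, for $n\ge2$, $\mathrm{Coin}_n((r,q)_{0,\infty})=\{(z_0,\ldots,z_{n-1})\in Z^n: q_i(z_i)=r_{i+1}(z_{i+1}),\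 i=0,\ldots,n-2\}$. For $z\in Z$, $\mathrm{Coin}_n((r,q)_{0,\infty},z)=\{(z_0,\ldots,z_{n-1})\in\mathrm{Coin}_n((r,q)_{0,\infty}): z_0=z\}$. For a pseudometric $d$ on a set $W$, $S\subset W$ is $(d,\varepsilon)$-separated if $d(x,y)>\varepsilon$ for all distinct $x,y\in S$; $R\subset W$ is $(d,\varepsilon)$-spanning in $Y\subset W$ if every $y\in Y$ has some $x\in R$ with $d(x,y)\le\varepsilon$. For $p\in\mathcal{V}$ put $p_n((z_i),(z'_i))=\max_{0\le i\le n-1}p(z_i,z'_i)$ on $Z^n$. Let $s_Z((r,q)_{0,\infty},p,\varepsilon,n)$ (resp. $s_Z((r,q)_{0,\infty},p,\varepsilon,n,z)$) be the largest cardinality of a $(p_n,\varepsilon)$-separated subset of $\mathrm{Coin}_n((r,q)_{0,\infty})$ (resp. of $\mathrm{Coin}_n((r,q)_{0,\infty},z)$); these are finite. Define $$h_Z((r,q)_{0,\infty})=\sup_{p\in\mathcal{V},\varepsilon>0}\limsup_{n\to\infty}\tfrac1n\log s_Z((r,q)_{0,\infty},p,\varepsilon,n),$$ $$h_{\mathfrak{p}}^Z((r,q)_{0,\infty})=\sup_{z\in Z}\sup_{p\in\mathcal{V},\varepsilon>0}\limsup_{n\to\infty}\tfrac1n\log s_Z((r,q)_{0,\infty},p,\varepsilon,n,z),$$ $$h_{\mathfrak{m}}^Z((r,q)_{0,\infty})=\sup_{p\in\mathcal{V},\varepsilon>0}\limsup_{n\to\infty}\tfrac1n\log\Big[\sup_{z\in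 Z}s_Z((r,q)_{0,\infty},p,\varepsilon,n,z)\Big].$$ The same values are obtained with smallest cardinalities of $(p_n,\varepsilon)$-spanning sets contained in, and spanning in, the respective sets of orbits. Define the pseudometric $p_n^b$ on $Z$ by $$p_n^b(u,v)=\max\Big\{\sup_{\overline{u}\in\mathrm{Coin}_n((r,q)_{0,\infty},u)}\ \inf_{\overline{v}\in\mathrm{Coin}_n((r,q)_{0,\infty},v)}p_n(\overline{u},\overline{v}),\ \sup_{\overline{v}\in\mathrm{Coin}_n((r,q)_{0,\infty},v)}\ \inf_{\overline{u}\in\mathrm{Coin}_n((r,q)_{0,\infty},u)}p_n(\overline{v},\overline{u})\Big\}.$$ Let $s((r,q)_{0,\infty},p_n^b,\varepsilon,Z)$ be the supremum of the cardinalities of $(p_n^b,\varepsilon)$-separated subsets of $Z$, and let $\mathrm{Fin}(\kappa)=\kappa$ if $\kappa$ is a finite cardinal and $\mathrm{Fin}(\kappa)=\infty$ if $\kappa$ is an infinite cardinal. Define $$h_{\mathfrak{i}}^Z((r,q)_{0,\infty})=\sup_{p\in\mathcal{V},\varepsilon>0}\limsup_{n\to\infty}\tfrac1n\log\mathrm{Fin}(s((r,q)_{0,\infty},p_n^b,\varepsilon,Z))$$ (equivalently with the smallest cardinality of a $(p_n^b,\varepsilon)$-spanning set in $Z$). *)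

(* Defs.v *)
From mathcomp Require Import all_boot all_order all_algebra.
From mathcomp Require Import all_classical all_reals all_analysis.

Set Implicit Arguments.
Unset Strict Implicit.
Unset Printing Implicit Defensive.

Import Order.TTheory GRing.Theory Num.Theory.
Import numFieldNormedType.Exports.

Local Open Scope classical_set_scope.
Local Open Scope ring_scope.

Definition pseudometric (R : realType) (S : Type) (d : S -> S -> R) : Prop :=
  [/\ forall x y, 0 <= d x y,
      forall x, d x x = 0,
      forall x y, d x y = d y x &
      forall x y z, d x z <= d x y + d y z].

Record uniformity (R : realType) (S : Type) (V : set (S -> S -> R)) : Prop := {
  uniformity_nonempty : V !=set0;
  uniformity_pseudometric : forall p, V p -> pseudometric p;
  uniformity_max : forall p0 p1, V p0 -> V p1 ->
    V (fun x y => Num.max (p0 x y) (p1 x y));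
  uniformity_saturated : forall p, pseudometric p ->
    (forall e : R, 0 < e -> exists p' (delta : R), [/\ V p', 0 < delta &
       forall x y, p' x y < delta -> p x y < e]) ->
    V p;
  uniformity_separating : forall x y, x <> y -> exists2 p, V p & 0 < p x y
}.

Definition pball (R : realType) (S : Type) (p : S -> S -> R) (x : S) (e : R) :
  set S := [set y | p x y < e].

Definition induces_topology (R : realType) (Z : topologicalType)
    (V : set (Z -> Z -> R)) : Prop :=
  basis [set U : set Z |
    exists p x (e : R), [/\ V p, 0 < e & U = pball p x e]].

(* As q and r are indexed from 0 and the condition below is void for n = 1,
   coin r q 1 is Z^1, identified with Z.  Only n >= 1 is meaningful; the value
   at n = 0 is irrelevant as only limits superior in n are taken. *)
Definition coin (X Z : Type) (r q : nat -> Z -> X) (n : nat) :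
  set ('I_n -> Z) :=
  [set z | forall i j : 'I_n, j = i.+1 :> nat -> q i (z i) = r j (z j)].

Definition coin_at (X Z : Type) (r q : nat -> Z -> X) (n : nat) (z0 : Z) :
  set ('I_n -> Z) :=
  [set z | coin r q z /\ forall i : 'I_n, i = 0%N :> nat -> z i = z0].

(* The default value 0 of the maximum is harmless: pseudometrics are
   nonnegative. *)
Definition dist_n (R : realType) (Z : Type) (p : Z -> Z -> R) (n : nat)
    (z z' : 'I_n -> Z) : R :=
  \big[Num.max/0]_(i < n) p (z i) (z' i).

(* The suprema and infima are those of real sets.  They are genuine ones when
   the r_j are surjective (so that every coin_at r q n u is nonempty) and p
   is bounded, as is every p in the uniformity of a compact space. *)
Definition dist_b (R : realType) (X Z : Type) (r q : nat -> Z -> X)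
    (p : Z -> Z -> R) (n : nat) (u v : Z) : R :=
  Num.max
    (sup [set inf [set dist_n p u' v' | v' in @coin_at X Z r q n v]
         | u' in @coin_at X Z r q n u])
    (sup [set inf [set dist_n p v' u' | u' in @coin_at X Z r q n u]
         | v' in @coin_at X Z r q n v]).

Definition separated_set (R : realType) (W : Type) (d : W -> W -> R) (e : R)
    (S : set W) : Prop :=
  forall x y, S x -> S y -> x <> y -> e < d x y.

(* Cardinalities live in \bar R: [counting S] is the number of elements of S
   when S is finite and +oo otherwise, so a supremum of cardinalities which is
   an infinite cardinal is +oo, as prescribed by Fin. *)
Definition sep_card (R : realType) (W : choiceType) (d : W -> W -> R) (e : R)
    (A : set W) : \bar R :=
  ereal_sup [set counting S | S in [set S | S `<=` A /\ separated_set d e S]].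

Definition exp_growth (R : realType) (s : nat -> \bar R) : \bar R :=
  limn_esup (fun n => ((n%:R^-1)%:E * lne (s n))%E).

Section Entropies.
Variables (R : realType) (X : Type) (Z : choiceType).
Variables (V : set (Z -> Z -> R)) (r q : nat -> Z -> X).

Definition sup_growth (s : (Z -> Z -> R) -> R -> nat -> \bar R) : \bar R :=
  ereal_sup [set exp_growth (s pe.1 pe.2)
            | pe in [set pe : (Z -> Z -> R) * R | V pe.1 /\ 0 < pe.2]].

Definition s_coin (p : Z -> Z -> R) (e : R) (n : nat) : \bar R :=
  sep_card (@dist_n R Z p n) e (@coin X Z r q n).

Definition s_coin_at (p : Z -> Z -> R) (e : R) (n : nat) (z : Z) : \bar R :=
  sep_card (@dist_n R Z p n) e (@coin_at X Z r q n z).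

Definition s_b (p : Z -> Z -> R) (e : R) (n : nat) : \bar R :=
  sep_card (dist_b r q p n) e [set: Z].

Definition h_top : \bar R := sup_growth s_coin.

Definition h_point : \bar R :=
  ereal_sup [set sup_growth (fun p e n => s_coin_at p e n z) | z in [set: Z]].

Definition h_max : \bar R :=
  sup_growth (fun p e n => ereal_sup [set s_coin_at p e n z | z in [set: Z]]).

Definition h_branch : \bar R := sup_growth s_b.

End Entropies.

(* Main.v *)
Require Import Defs.
From mathcomp Require Import all_boot all_order all_algebra.
From mathcomp Require Import all_classical all_reals all_analysis.
From mathcomp Require Import lra.

(** The first two inequalities hold term by term: a separated set of orbits
    issued from one point is also a separated set of orbits.

    The third one rests on a product bound at each time [n]. An orbit is
    determined, up to a small error, by two pieces of data: its initial
    point up to [dist_b], and an orbit issued from a nearby centre up to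
    [dist_n]. By definition of the Hausdorff-type distance [dist_b], an orbit
    issued from [u] is shadowed by one issued from [z] as soon as [u] and [z]
    are [dist_b]-close. Choosing the centres in a maximal [dist_b]-separated
    set, and the orbits over each centre in a maximal [dist_n]-separated set,
    gives (see [s_coin_le])

      [s_coin (6 e) n <= s_b e n * sup_z s_coin_at e n z].

    Taking logarithms turns the product into a sum ([exp_growthM_le]), the
    upper limit is subadditive on nonnegative sequences, and [6 e] is as good a
    scale as [e] since the entropies are suprema over all scales.

    Compactness serves to bound the
    pseudometrics ([uniformity_bounded]), so that the supremum in [dist_b]
    controls each single orbit; surjectivity of the [r j] makes orbits with a
    prescribed initial point exist ([coin_at_nonempty]), so that the infima in
    [dist_b] are approached and each [s_coin_at e n z] is at least 1. *)

Set Implicit Arguments.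
Unset Strict Implicit.
Unset Printing Implicit Defensive.

Import Order.TTheory GRing.Theory Num.Theory.

Local Open Scope classical_set_scope.
Local Open Scope ereal_scope.

(** * Exponential growth rates *)

Lemma le_lne (R : realType) (x y : \bar R) : x <= y -> lne x <= lne y.
Proof.
move=> xy; have [x0|x0] := leP x 0; first by rewrite le0_lneNy// leNye.
by rewrite lee_lne// in_itv/= leey andbT ltW// (lt_le_trans x0).
Qed.

Lemma le_limn_esup (R : realType) (u v : (\bar R)^nat) :
  (forall n, u n <= v n) -> limn_esup u <= limn_esup v.
Proof.
move=> uv; rewrite !limn_esup_lim; apply: lee_lim; [exact: is_cvg_esups..|].
apply: nearW => n; apply: ge_ereal_sup => _ [k /= nk <-].
by apply: le_trans (uv k) _; apply: ereal_sup_ubound; exists k.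
Qed.

Lemma limn_esupD_le (R : realType) (u v : (\bar R)^nat) :
  (forall n, 0 <= u n) -> (forall n, 0 <= v n) ->
  limn_esup (fun n => u n + v n) <= limn_esup u + limn_esup v.
Proof.
move=> u0 v0.
have esups_ge0 (w : (\bar R)^nat) : (forall n, 0 <= w n) ->
    0 <= limn (esups w).
  move=> w0; apply: lime_ge; first exact: is_cvg_esups.
  apply: nearW => n; apply: le_trans (w0 n) _.
  by apply: ereal_sup_ubound; exists n => /=.
have def : limn (esups u) +? limn (esups v).
  by apply: ge0_adde_def; rewrite inE; apply: esups_ge0.
rewrite !limn_esup_lim -limeD//; [|exact: is_cvg_esups..].
apply: lee_lim; [exact: is_cvg_esups| |].
  by apply: is_cvgeD => //; exact: is_cvg_esups.
apply: nearW => n; apply: ge_ereal_sup => _ [k /= nk <-].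
by apply: leeD; apply: ereal_sup_ubound; exists k.
Qed.

Lemma growth_term_ge0 (R : realType) (s : nat -> \bar R) (n : nat) :
  1 <= s n -> 0 <= (n%:R^-1)%:E * lne (s n).
Proof.
by move=> s1; apply: mule_ge0; rewrite ?lne_ge0// lee_fin invr_ge0 ler0n.
Qed.

Lemma le_exp_growth (R : realType) (s t : nat -> \bar R) :
  (forall n, s n <= t n) -> exp_growth s <= exp_growth t.
Proof.
move=> st; apply: le_limn_esup => n; apply: lee_wpmul2l; last exact: le_lne.
by rewrite lee_fin invr_ge0 ler0n.
Qed.

(** The logarithm of a product is a sum, and as both factors are at least 1
    the logarithms are nonnegative, so the upper limit of the sum is at most
    the sum of the upper limits. The bound is only asked for positive indices
    because the term of index 0 has the factor [0^-1 = 0]. *)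
Lemma exp_growthM_le (R : realType) (s t u : nat -> \bar R) :
  (forall n, 1 <= t n) -> (forall n, 1 <= u n) ->
  (forall n, s n.+1 <= t n.+1 * u n.+1) ->
  exp_growth s <= exp_growth t + exp_growth u.
Proof.
move=> t1 u1 stu.
apply: le_trans (limn_esupD_le _ _); [|by move=> n; exact: growth_term_ge0..].
apply: le_limn_esup => -[|n]; first by rewrite invr0 !mul0e adde0.
rewrite -ge0_muleDr ?lne_ge0// -lneM; last 2 first.
- by rewrite in_itv/= leey andbT (lt_le_trans _ (t1 _))// lte01.
- by rewrite in_itv/= leey andbT (lt_le_trans _ (u1 _))// lte01.
by apply: lee_wpmul2l; [rewrite lee_fin invr_ge0 ler0n|exact: le_lne].
Qed.

Lemma le_sup_growth (R : realType) (Z : choiceType) (V : set (Z -> Z -> R))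
    (s t : (Z -> Z -> R) -> R -> nat -> \bar R) :
  (forall p e n, s p e n <= t p e n) -> sup_growth V s <= sup_growth V t.
Proof.
move=> st; apply: ge_ereal_sup => _ [pe Vpe <-].
apply: le_trans (le_exp_growth (st _ _)) _.
by apply: ereal_sup_ubound; exists pe.
Qed.

(** * Counting and separated sets *)

Lemma counting_set1 (R : realType) (T : choiceType) (x : T) :
  counting [set x] = 1 :> \bar R.
Proof. by rewrite /counting asboolT// fset_set1 finmap.cardfs1. Qed.

Lemma counting_ge1 (R : realType) (T : choiceType) (A : set T) :
  A !=set0 -> 1 <= counting A :> \bar R.
Proof.
move=> [x Ax]; rewrite /counting; case: ifPn => [/asboolP fA|]; last first.
  by rewrite leey.
rewrite lee_fin ler1n finmap.cardfs_gt0; apply/finmap.fset0Pn; exists x.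
by rewrite in_fset_set// inE.
Qed.

(** Number the elements of [E] and of each [F z], and send a point [s] to the
    pair formed by the numbers of [f s] and [g s], read as a two-digit number
    in base the integral part of [M]. Nonemptiness of [E] and [1 <= M] exclude
    the product of 0 and infinity, which is 0 by convention. *)
Lemma counting_fibred_le (R : realType) (T U W : choiceType) (S : set T)
    (E : set U) (F : U -> set W) (f : T -> U) (g : T -> W) (M : \bar R) :
  (forall s, S s -> E (f s)) -> (forall s, S s -> F (f s) (g s)) ->
  (forall s t, S s -> S t -> f s = f t -> g s = g t -> s = t) ->
  E !=set0 -> 1 <= M -> (forall z, E z -> counting (F z) <= M) ->
  counting S <= counting E * M.
Proof.
move=> Sf Sg inj E0 M1 FM.
have cE1 := counting_ge1 R E0.
have [->|Mfin] := eqVneq M +oo.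
  by rewrite gt0_muley ?leey// (lt_le_trans _ cE1)// lte01.
have {Mfin} : M \is a fin_num.
  by rewrite fin_numElt (lt_le_trans _ M1) ?ltNyr//= ltey.
case: M M1 FM => // m; rewrite lee_fin => m1 FM _.
have [fE|nfE] := pselect (finite_set E); last first.
  rewrite [counting E]/counting (asboolF nfE) gt0_mulye ?leey//.
  by rewrite lte_fin (lt_le_trans ltr01).
have m0 : (0 <= m)%R by apply: le_trans m1.
rewrite [counting E]/counting (asboolT fE); set eE := finmap.enum_fset (fset_set E).
set b := Num.truncn m.
have bm : (b%:R <= m)%R by rewrite truncn_le.
have FE z : E z -> finite_set (F z) /\
    (size (finmap.enum_fset (fset_set (F z))) <= b)%N.
  move=> /FM; rewrite /counting; case: ifPn => [/asboolP fF|_].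
    by rewrite lee_fin truncn_ge_nat.
  by rewrite leye_eq.
pose rk s := index (g s) (finmap.enum_fset (fset_set (F (f s)))).
have rk_lt s : S s -> (rk s < b)%N.
  move=> Ss; have [fF] := FE _ (Sf _ Ss); apply: leq_trans.
  by rewrite index_mem in_fset_set// inE; exact: Sg.
have if_lt s : S s -> (index (f s) eE < size eE)%N.
  by move=> Ss; rewrite index_mem in_fset_set// inE; exact: Sf.
pose h s := (index (f s) eE * b + rk s)%N.
have hinj : {in S &, injective h}.
  move=> s t; rewrite !inE => Ss St hst.
  have b0 : (0 < b)%N by apply: leq_ltn_trans (rk_lt _ Ss).
  have ist : index (f s) eE = index (f t) eE.
    have /(congr1 (fun n => n %/ b)%N) := hst.
    by rewrite /h !divnMDl// !divn_small ?addn0 ?rk_lt.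
  have rst : rk s = rk t.
    have /(congr1 (fun n => n %% b)%N) := hst.
    by rewrite /h !modnMDl !modn_small ?rk_lt.
  have fst : f s = f t.
    apply: (index_inj (f s) _ _ ist); rewrite in_fset_set// inE; exact: Sf.
  apply: inj => //; move: rst; rewrite /rk -fst => rst.
  have [fF _] := FE _ (Sf _ Ss).
  apply: (index_inj (g s) _ _ rst); rewrite in_fset_set// inE; first exact: Sg.
  by rewrite fst; exact: Sg.
have SI : (S #<= `I_(size eE * b))%card.
  rewrite -(card_le_eql (inj_card_eq hinj)); apply: subset_card_le.
  move=> _ [s Ss <-] /=; rewrite /h.
  apply: (@leq_trans (index (f s) eE * b + b)); first by rewrite ltn_add2l rk_lt.
  by rewrite addnC -mulSn leq_mul2r if_lt ?orbT.
have fS : finite_set S by apply: card_le_finite SI _; exact: finite_II.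
rewrite /counting (asboolT fS) -EFinM lee_fin.
apply: (@le_trans _ _ (size eE * b)%:R%R); first by rewrite ler_nat geq_card_fset_set.
by rewrite natrM ler_wpM2l.
Qed.

Lemma sep_card_ge (R : realType) (W : choiceType) (d : W -> W -> R) (e : R)
    (A S : set W) : S `<=` A -> separated_set d e S ->
  counting S <= sep_card d e A.
Proof. by move=> SA dS; apply: ereal_sup_ubound; exists S. Qed.

Lemma sep_card_ge1 (R : realType) (W : choiceType) (d : W -> W -> R) (e : R)
    (A : set W) : A !=set0 -> 1 <= sep_card d e A.
Proof.
move=> [x Ax]; rewrite -(counting_set1 R x); apply: sep_card_ge.
  by move=> _ ->.
by move=> y z -> -> /(_ erefl).
Qed.

Lemma subset_sep_card (R : realType) (W : choiceType) (d : W -> W -> R) (e : R)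
    (A B : set W) : A `<=` B -> sep_card d e A <= sep_card d e B.
Proof.
move=> AB; apply: ge_ereal_sup => _ [S [SA dS] <-].
by apply: sep_card_ge => //; exact: subset_trans AB.
Qed.

(** A maximal separated set is spanning, as a point which it does not span
    could be added to it; a maximal one exists by Zorn's lemma. *)
Lemma separated_spanning (R : realType) (W : Type) (d : W -> W -> R) (e : R)
    (A : set W) : (forall x y, d x y = d y x) ->
  exists S, [/\ S `<=` A, separated_set d e S &
    forall x, A x -> exists2 y, S y & x = y \/ (d x y <= e)%R].
Proof.
move=> dC.
have [] := @Zorn_bigcup W [set S | S `<=` A /\ separated_set d e S].
  move=> F FP Ftot; split; first by move=> x [S /FP[SA _] /SA].
  move=> x y [S FS Sx] [S' FS' S'y].
  by have [SS'|SS'] := Ftot _ _ FS FS';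
    [apply: (FP _ FS').2|apply: (FP _ FS).2] => //; exact: SS'.
move=> S [[SA dS] maxS]; exists S; split=> // x Ax.
apply: contrapT => nx.
have far y : S y -> (e < d x y)%R.
  by move=> Sy; rewrite ltNge; apply/negP => xy; apply: nx; exists y; [|right].
apply: (maxS (S `|` [set x])); first split.
- by move=> y Sy; left.
- by move=> /(_ x (or_intror erefl)) Sx; apply: nx; exists x; [|left].
- split; first by move=> y [/SA//|->].
  move=> y z [Sy|->] [Sz|->] yz //; [exact: dS|by rewrite dC; exact: far|exact: far].
Qed.

(** * Orbits of coincidences *)

Lemma dist_n_ge (R : realType) (Z : Type) (p : Z -> Z -> R) (n : nat)
    (z z' : 'I_n -> Z) (i : 'I_n) : (p (z i) (z' i) <= dist_n p z z')%R.
Proof. exact: (le_bigmax _ (fun i => p (z i) (z' i))). Qed.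

Lemma dist_n_le (R : realType) (Z : Type) (p : Z -> Z -> R) (n : nat)
    (z z' : 'I_n -> Z) (c : R) : (0 <= c)%R ->
  (forall i, p (z i) (z' i) <= c)%R -> (dist_n p z z' <= c)%R.
Proof. by move=> c0 pc; apply/bigmax_leP; split=> // i _; exact: pc. Qed.

Lemma dist_n_pseudometric (R : realType) (Z : Type) (p : Z -> Z -> R)
    (n : nat) : pseudometric p -> pseudometric (@dist_n R Z p n).
Proof.
move=> [p0 pxx pC pD].
have d0 (x y : 'I_n -> Z) : (0 <= dist_n p x y)%R by exact: bigmax_ge_id.
split=> [//|x|x y|x y z].
- by apply/le_anti; rewrite d0 dist_n_le// => i; rewrite pxx.
- by apply: eq_bigr => i _; rewrite pC.
- apply: dist_n_le => [|i]; first by rewrite addr_ge0.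
  by rewrite (le_trans (pD _ (y i) _))// lerD// dist_n_ge.
Qed.

(** Surjectivity of the [r j] allows an orbit to be continued forever. *)
Lemma coin_at_nonempty (X Z : Type) (r q : nat -> Z -> X) (n : nat) (z0 : Z) :
  (forall j, set_surj [set: Z] [set: X] (r j)) ->
  @coin_at X Z r q n z0 !=set0.
Proof.
move=> rsurj.
have /choice[s sP] (jx : nat * X) : exists z, r jx.1 z = jx.2.
  by have [z _ ?] := rsurj jx.1 jx.2 I; exists z.
pose orb := fix orb k := if k is k'.+1 then s (k'.+1, q k' (orb k')) else z0.
exists (fun i => orb i); split=> [i j ->|i -> //] /=.
by rewrite (sP (i.+1, _)).
Qed.

Lemma dist_bC (R : realType) (X Z : Type) (r q : nat -> Z -> X)
    (p : Z -> Z -> R) (n : nat) (u v : Z) :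
  dist_b r q p n u v = dist_b r q p n v u.
Proof. by rewrite /dist_b maxC. Qed.

(** This is what [dist_b] is designed for. The gap between [a] and [b] is needed
    as the infimum over orbits may not be attained, and the bound [B] makes
    the supremum in [dist_b] a true upper bound. *)
Lemma dist_b_shadow (R : realType) (X Z : Type) (r q : nat -> Z -> X)
    (p : Z -> Z -> R) (n : nat) (B a b : R) (u v : Z) (x : 'I_n -> Z) :
  (forall j, set_surj [set: Z] [set: X] (r j)) ->
  pseudometric p -> (forall y z, p y z <= B)%R ->
  (a < b)%R -> (dist_b r q p n u v <= a)%R -> coin_at r q u x ->
  exists2 y, coin_at r q v y & (dist_n p x y < b)%R.
Proof.
move=> rsurj pp pB ab duv ux.
have [d0 _ _ _] := dist_n_pseudometric n pp.
have [w vw] := coin_at_nonempty q n v rsurj.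
have infB (x' : 'I_n -> Z) :
    (inf [set dist_n p x' y | y in coin_at r q v] <= B)%R.
  apply: (@le_trans _ _ (dist_n p x' w)).
    apply: ge_inf; last by exists w.
    by exists 0%R => _ [y _ <-].
  by apply: dist_n_le => //; apply: le_trans (pB v v); have [] := pp.
have infa : (inf [set dist_n p x y | y in coin_at r q v] < b)%R.
  apply: le_lt_trans ab; apply: le_trans duv; rewrite le_max; apply/orP; left.
  apply: ub_le_sup; last by exists x.
  by exists B => _ [x' _ <-].
have [_ [y vy <-] yb] := inf_lt (ex_intro _ _ (ex_intro2 _ _ w vw erefl)) infa.
by exists y.
Qed.

(** Finitely many unit balls cover the space. This is expressed through near
    coverings: near each [z] the distance to [z0] is at most [p z0 z + 1], so it
    is bounded by every large [B], hence by one [B] for the whole space. *)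
Lemma uniformity_bounded (R : realType) (Z : topologicalType)
    (V : set (Z -> Z -> R)) (p : Z -> Z -> R) :
  compact [set: Z] -> [set: Z] !=set0 -> uniformity V -> induces_topology V ->
  V p -> exists B : R, forall u v, (p u v <= B)%R.
Proof.
move=> cZ [z0 _] uV [Vopen _] Vp.
have [p0 pxx pC pD] := uniformity_pseudometric uV Vp.
have /compact_near_coveringP cov := cZ.
have := cov R (pinfty_nbhs R) (fun B z => p z0 z < B)%R _.
case=> [z _|B [_ BP]].
  exists (pball p z 1, [set B | p z0 z + 1 < B]%R).
    split=> /=; last by apply: nbhs_pinfty_gt; exact: num_real.
    apply: open_nbhs_nbhs; split; last by rewrite /pball/= pxx.
    by apply: Vopen; exists p, z, 1%R.
  move=> [y B] /= [zy zB]; apply: le_lt_trans zB.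
  by rewrite (le_trans (pD _ z _))// lerD2l ltW.
have {}BP y : (p z0 y < B + 1)%R by apply: BP => //; rewrite ltrDl.
exists ((B + 1) + (B + 1))%R => u v; rewrite (le_trans (pD _ z0 _))// lerD//.
  by rewrite pC ltW.
exact: ltW.
Qed.

(** * The three inequalities *)

(** To each orbit of a separated set attach a centre [z] that is [dist_b]-close to
    its initial point, and an element of a spanning set of orbits issued from
    [z]. The orbit is within [2 e] of an orbit issued from [z], which is
    within [e] of the spanning set. Two orbits with the same data are
    thus at distance less than [6 e], and so coincide. *)
Lemma s_coin_le (R : realType) (X : Type) (Z : choiceType) (r q : nat -> Z -> X)
    (p : Z -> Z -> R) (B e : R) (n : nat) :
  (forall j, set_surj [set: Z] [set: X] (r j)) -> [set: Z] !=set0 ->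
  pseudometric p -> (forall y z, p y z <= B)%R -> (0 < e)%R ->
  s_coin r q p (e *+ 6) n.+1 <=
  s_b r q p e n.+1 * ereal_sup [set s_coin_at r q p e n.+1 z | z in [set: Z]].
Proof.
move=> rsurj [z0 _] pp pB e0.
set M := ereal_sup _.
have [d0 dxx dC dD] := dist_n_pseudometric n.+1 pp.
have FM z : s_coin_at r q p e n.+1 z <= M by apply: ereal_sup_ubound; exists z.
have M1 : 1 <= M.
  apply: le_trans (FM z0); apply: sep_card_ge1; exact: coin_at_nonempty.
have [E [_ dE spanE]] := separated_spanning e [set: Z] (dist_bC r q p n.+1).
have /choice[F FP] z := separated_spanning e (@coin_at X Z r q n.+1 z) dC.
have [y0 Ey0 _] := spanE z0 I.
apply: ge_ereal_sup => _ [S [SA dS] <-].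
have /choice[fg fgP] (s : 'I_n.+1 -> Z) : exists zw : Z * ('I_n.+1 -> Z),
    S s -> [/\ E zw.1, F zw.1 zw.2 & (dist_n p s zw.2 < e *+ 3)%R].
  have [Ss|nSs] := pselect (S s); last by exists (z0, s).
  have us : coin_at r q (s ord0) s.
    by split=> [|i i0]; [exact: SA|congr s; exact: val_inj].
  have [z Ez sz] := spanE (s ord0) I.
  have [y zy sy] : exists2 y, coin_at r q z y & (dist_n p s y < e *+ 2)%R.
    have e2 : (e < e *+ 2)%R by lra.
    case: sz => [<-|sz]; last exact: dist_b_shadow e2 sz us.
    by exists s => //; rewrite dxx; lra.
  have [_ _ /(_ y zy)[w Fw yw]] := FP z.
  exists (z, w) => _; split=> //=.
  case: yw => [<-|yw]; first by lra.
  by have := dD s y w; lra.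
apply: (@le_trans _ _ (counting E * M)); last first.
  apply: lee_wpmul2r; first by rewrite (le_trans lee01).
  exact: sep_card_ge.
apply: (@counting_fibred_le _ _ _ _ _ _ F (fst \o fg) (snd \o fg)) => //=.
- by move=> s /fgP[].
- by move=> s /fgP[].
- move=> s t Ss St _ gst; apply: contrapT => st.
  have := dS _ _ Ss St st.
  have [_ _ sw] := fgP _ Ss; have [_ _ tw] := fgP _ St.
  move: gst tw; rewrite /= => <-; rewrite dC => wt.
  by have := dD s (fg s).2 t; lra.
- by exists y0.
- move=> z _; apply: le_trans (FM z); have [FA dF _] := FP z.
  exact: sep_card_ge.
Qed.

Theorem theorem5p16 (R : realType) (X Z : topologicalType)
    (cX : compact [set: X]) (hX : hausdorff_space X)
    (cZ : compact [set: Z]) (hZ : hausdorff_space Z) (Z0 : [set: Z] !=set0)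
    (V : set (Z -> Z -> R)) (uV : uniformity V) (tV : induces_topology V)
    (r q : nat -> Z -> X)
    (r_surj : forall j : nat, set_surj [set: Z] [set: X] (r j)) :
  [/\ h_point V r q <= h_max V r q,
      h_max V r q <= h_top V r q &
      h_top V r q <= h_max V r q + h_branch V r q].
Proof.
split.
- apply: ge_ereal_sup => _ [z _ <-]; apply: le_sup_growth => p e n.
  by apply: ereal_sup_ubound; exists z.
- apply: le_sup_growth => p e n; apply: ge_ereal_sup => _ [z _ <-].
  by apply: subset_sep_card => x [].
- apply: ge_ereal_sup => _ [[p e] /= [Vp e0] <-].
  have [B pB] := uniformity_bounded cZ Z0 uV tV Vp.
  have [z0 _] := Z0.
  set m := fun n => ereal_sup
    [set s_coin_at r q p (e / 6)%R n z | z in [set: Z]].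
  have e6 : (0 < e / 6)%R by lra.
  have m1 n : 1 <= m n.
    apply: (@le_trans _ _ (s_coin_at r q p (e / 6)%R n z0)).
      apply: sep_card_ge1; exact: coin_at_nonempty.
    by apply: ereal_sup_ubound; exists z0.
  have b1 n : 1 <= s_b r q p (e / 6)%R n by exact: sep_card_ge1.
  apply: (@le_trans _ _ (exp_growth m + exp_growth (s_b r q p (e / 6)%R))).
    apply: exp_growthM_le => // n; rewrite muleC.
    have -> : s_coin r q p e = s_coin r q p ((e / 6) *+ 6)%R.
      by congr s_coin; lra.
    apply: s_coin_le pB e6 => //; exact: uniformity_pseudometric uV _ Vp.
  by apply: leeD; apply: ereal_sup_ubound; exists (p, (e / 6)%R).
Qed.
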